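(* Let $(X,Y)$ be a dual pair over a Hausdorff topological field $\mathbb{F}$, let $\mathcal{A}$ be an abelian unital subalgebra of $L_{\sigma(X,Y)}(X)$, and let $x\in X$, $\alpha\in Y$ satisfy $(x\otimes\alpha)(1)=\alpha(x)=1$. Then $\mathcal{A}$ is maximal tracial with respect to $x\otimes\alpha$ (in $L_{\sigma(X,Y)}(X)$) if and only if the following three conditions hold: (1) $\mathcal{A}$ is maximal abelian in $L_{\sigma(X,Y)}(X)$; (2) $[\mathcal{A}x]^{-\sigma(X,Y)}=X$; (3) $[\mathcal{A}^{\#}\alpha]^{-\sigma(Y,X)}=Y$.
   Context: Let $\mathbb{F}$ be a topological field whose topology is Hausdorff. A dual pair $(X,Y)$ over $\mathbb{F}$ consists of a vector space $X$ over $\mathbb{F}$ and a vector space $Y$ of linear maps $X\to\mathbb{F}$ with $\bigcap\{\ker f: f\in Y\}=\{0\}$. The $\sigma(X,Y)$-topology on $X$ is the smallest topology making every $f\in Y$ continuous; the $\sigma(Y,X)$-topology on $Y$ is the smallest topology making $f\mapsto f(x)$ continuous on $Y$ for every $x\in X$. $L_{\sigma(X,Y)}(X)$ is the algebra of linear maps $T:X\to X$ that are $\sigma(X,Y)$-$\sigma(X,Y)$ continuous, with unit $1$ the identity map; $L_{\sigma(Y,X)}(Y)$ is defined analogously. Each $T\in L_{\sigma(X,Y)}(X)$ has an adjoint $T^{\#}\in L_{\sigma(Y,X)}(Y)$ determined by $\alpha(Tx)=(T^{\#}\alpha)(x)$ for all $x\in X$, $\alpha\in Y$; for a set $\mathcal{S}$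 of such maps, $\mathcal{S}^{\#}=\{S^{\#}:S\in\mathcal{S}\}$. For $x\in X$ and $\alpha\in Y$, $x\otimes\alpha$ is the linear functional on $L_{\sigma(X,Y)}(X)$ given by $(x\otimes\alpha)(T)=\alpha(Tx)$. We write $[\mathcal{A}x]=\{Ax:A\in\mathcal{A}\}$ and $[\mathcal{A}^{\#}\alpha]=\{A^{\#}\alpha:A\in\mathcal{A}\}$; $[\,\cdot\,]^{-\sigma(X,Y)}$ and $[\,\cdot\,]^{-\sigma(Y,X)}$ denote closures in the indicated topologies. If $\mathcal{B}$ is a unital algebra over $\mathbb{F}$ and $\varphi:\mathcal{B}\to\mathbb{F}$ is linear with $\varphi(1)=1$, a subalgebra $\mathcal{A}$ of $\mathcal{B}$ with $1\in\mathcal{A}$ is tracial for $\varphi$ (or $\varphi$-tracial) if $\varphi(ab)=\varphi(ba)$ for all $a,b\in\mathcal{A}$; it is maximal tracial for $\varphi$ in $\mathcal{B}$ if it is $\varphi$-tracial and no strictly larger subalgebra of $\mathcal{B}$ is $\varphi$-tracial. A subalgebra is maximal abelian if it is abelian and not properly contained in another abelian subalgebra. *)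

(* Defs.v *)
From HB Require Import structures.
From mathcomp Require Import all_boot all_algebra.
From mathcomp Require Import boolp classical_sets functions topology tvs.

Set Implicit Arguments.
Unset Strict Implicit.
Unset Printing Implicit Defensive.

Import GRing.Theory.

Local Open Scope classical_set_scope.
Local Open Scope ring_scope.

(* Topological fields.  MathComp-Analysis only topologizes ordered or normed
   fields, so the structure is introduced on top of topologicalZmodType; it
   does not include the Hausdorff axiom. *)
HB.mixin Record TopologicalZmodule_isTopologicalField F
    & TopologicalZmodule F & GRing.Field F := {
  tf_mul_continuous : continuous (fun z : F * F => z.1 * z.2) ;
  tf_inv_continuous : forall x : F, x != 0 ->
    {for x, continuous (@GRing.inv F)}
}.

#[short(type="topologicalFieldType")]
HB.structure Definition TopologicalField :=
  {F of TopologicalZmodule F & GRing.Field F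
      & TopologicalZmodule_isTopologicalField F}.

Lemma cvg_linear_comb (F : topologicalFieldType) (S : Type) (G : set_system S)
    (FG : Filter G) (f g : S -> F) (k a b : F) :
  f @ G --> a -> g @ G --> b -> (fun x => k * f x + g x) @ G --> k * a + b.
Proof.
move=> fa gb.
apply: (continuous2_cvg FG (h := +%R)) gb.
  exact: (@add_continuous F (k * a, b)).
apply: (continuous2_cvg FG (h := *%R)) (cvg_cst k) fa.
exact: (@tf_mul_continuous F (k, a)).
Qed.

(* V with the smallest topology making every e i continuous. *)
Definition sigma_space (F : topologicalFieldType) (V : lmodType F) (I : Type)
  (e : I -> {scalar V}) : Type := V.

Section SigmaSpace.
Variables (F : topologicalFieldType) (V : lmodType F) (I : Type).
Variable e : I -> {scalar V}.

HB.instance Definition _ := GRing.Lmodule.on (sigma_space e).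
HB.instance Definition _ := Topological.copy (sigma_space e)
  (sup_topology (fun i => Topological.class
     (initial_topology (e i : V -> F)))).

Lemma cvg_sigma (G : set_system V) (v : V) : Filter G ->
  G --> (v : sigma_space e) <->
  forall i, G --> (v : initial_topology (e i : V -> F)).
Proof. exact: cvg_sup. Qed.

Lemma sigma_continuous (i : I) : continuous (e i : sigma_space e -> F).
Proof.
move=> v; have /cvg_sigma/(_ i) h : nbhs (v : sigma_space e) -->
  (v : sigma_space e) by [].
by apply: cvg_trans (@initial_continuous _ _ (e i : V -> F) v); exact: cvg_app.
Qed.

Lemma continuous_sigma (Z : topologicalType) (T : Z -> sigma_space e) :
  (forall i, continuous (fun z => e i (T z))) -> continuous T.
Proof.
move=> h z; apply/cvg_sigma => i.
exact: (@continuous_comp_initial _ _ _ (e i : V -> F) T (h i)).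
Qed.

(* The algebra of linear maps V -> V continuous for the topology of
   sigma_space e, with composition as product. *)
Definition sigma_endo_pred : {pred V -> V} := fun T =>
  `[< linear T /\ continuous (T : sigma_space e -> sigma_space e) >].

Record sigma_endo := SigmaEndo {
  sigma_endo_fun :> V -> V ;
  sigma_endoP : sigma_endo_fun \in sigma_endo_pred
}.

HB.instance Definition _ := [isSub for sigma_endo_fun].
HB.instance Definition _ := [Choice of sigma_endo by <:].

Lemma sigma_endo_linear (T : sigma_endo) : linear T.
Proof. by have /asboolP[] := sigma_endoP T. Qed.

Lemma sigma_endo_continuous (T : sigma_endo) :
  continuous (T : sigma_space e -> sigma_space e).
Proof. by have /asboolP[] := sigma_endoP T. Qed.

HB.instance Definition _ (T : sigma_endo) :=
  GRing.isLinear.Build F V V *:%R T (sigma_endo_linear T).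

Lemma sigma_endo_submod : GRing.submod_closed sigma_endo_pred.
Proof.
split=> [|k T S /asboolP[lT cT] /asboolP[lS cS]]; apply/asboolP; split.
- by move=> a u v /=; rewrite /= scaler0 addr0.
- by move=> v; apply: cst_continuous.
- move=> a u v; rewrite !fctE lT lS !scalerDr !scalerA (mulrC k a).
  by rewrite addrACA.
- apply: continuous_sigma => i v.
  have -> : (fun z : sigma_space e => e i ((k *: T + S) z)) =
            (fun z => k * e i (T z) + e i (S z)).
    by apply/funext => z; rewrite !fctE linearD linearZ.
  have cf (U : V -> V) : continuous (U : sigma_space e -> sigma_space e) ->
      {for (v : sigma_space e), continuous (fun z : sigma_space e => e i (U z) : F)}.
    move=> cU; apply: (@continuous_comp (sigma_space e) (sigma_space e) F U).
      exact: cU.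
    exact: sigma_continuous.
  exact: (@cvg_linear_comb F (sigma_space e) _ (nbhs_filter v)
    (fun z => e i (T z)) (fun z => e i (S z)) k _ _ (cf T cT) (cf S cS)).
Qed.

HB.instance Definition _ := GRing.SubChoice_isSubLmodule.Build F _ _ sigma_endo
  (GRing.submod_closed_semi sigma_endo_submod).

Lemma sigma_endo_id : idfun \in sigma_endo_pred.
Proof. by apply/asboolP; split=> // v; exact: cvg_id. Qed.

Lemma sigma_endo_comp (T S : sigma_endo) : T \o S \in sigma_endo_pred.
Proof.
apply/asboolP; split=> [a u v|v]; first by rewrite /= !linearP.
apply: (@continuous_comp (sigma_space e) (sigma_space e) (sigma_space e) S T);
  exact: sigma_endo_continuous.
Qed.

Definition sigma_endo_one := SigmaEndo sigma_endo_id.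
Definition sigma_endo_mul T S := SigmaEndo (sigma_endo_comp T S).

Lemma sigma_endo_eq (T S : sigma_endo) : (forall v, T v = S v) -> T = S.
Proof. by move=> h; apply: val_inj; apply/funext. Qed.

Lemma sigma_endoD (T S : sigma_endo) v : (T + S) v = T v + S v.
Proof. by []. Qed.

Lemma sigma_endoZ k (T : sigma_endo) v : (k *: T) v = k *: T v.
Proof. by []. Qed.

Fact sigma_endo_mulA : associative sigma_endo_mul.
Proof. by move=> T S U; exact: sigma_endo_eq. Qed.
Fact sigma_endo_mul1 : left_id sigma_endo_one sigma_endo_mul.
Proof. by move=> T; exact: sigma_endo_eq. Qed.
Fact sigma_endo_1mul : right_id sigma_endo_one sigma_endo_mul.
Proof. by move=> T; exact: sigma_endo_eq. Qed.
Fact sigma_endo_mulDl : left_distributive sigma_endo_mul +%R.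
Proof. by move=> T S U; exact: sigma_endo_eq. Qed.
Fact sigma_endo_mulDr : right_distributive sigma_endo_mul +%R.
Proof.
by move=> T S U; apply: sigma_endo_eq => v; rewrite sigma_endoD /= linearD.
Qed.

HB.instance Definition _ := GRing.Zmodule_isPzRing.Build sigma_endo
  sigma_endo_mulA sigma_endo_mul1 sigma_endo_1mul
  sigma_endo_mulDl sigma_endo_mulDr.

Lemma sigma_endo1E v : (1 : sigma_endo) v = v. Proof. by []. Qed.

Lemma sigma_endoME (T S : sigma_endo) v : (T * S) v = T (S v).
Proof. by []. Qed.

Lemma sigma_endo_scalerAl k (T S : sigma_endo) : k *: (T * S) = (k *: T) * S.
Proof. exact: sigma_endo_eq. Qed.
Lemma sigma_endo_scalerAr k (T S : sigma_endo) : k *: (T * S) = T * (k *: S).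
Proof.
apply: sigma_endo_eq => v.
by rewrite sigma_endoZ !sigma_endoME sigma_endoZ linearZ.
Qed.

(* sigma_endo is the zero ring when V = 0, so it has separate ring and module
   structures rather than an algType structure, which excludes that case.
   A subalgebra need not contain 1, but a tracial one must. *)
Definition subalgebra (A : set sigma_endo) : Prop :=
  GRing.submod_closed [in A] /\ GRing.mulr_2closed [in A].

Definition tracial (phi : {scalar sigma_endo}) (A : set sigma_endo) : Prop :=
  [/\ subalgebra A, A 1 &
      forall a b, A a -> A b -> phi (a * b) = phi (b * a)].

Definition maximal_tracial (phi : {scalar sigma_endo}) (A : set sigma_endo) : Prop :=
  tracial phi A /\ forall C : set sigma_endo, tracial phi C -> ~ A `<` C.

Definition abelian_subalgebra (A : set sigma_endo) : Prop :=
  subalgebra A /\ forall a b, A a -> A b -> a * b = b * a.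

Definition maximal_abelian (A : set sigma_endo) : Prop :=
  abelian_subalgebra A /\
  forall C : set sigma_endo, abelian_subalgebra C -> ~ A `<` C.

End SigmaSpace.

(* A dual pair (X, Y): Y is the subspace dp_functionals of the space of all
   functions X -> F; as a type it is dualY below. *)
Record dual_pair (F : topologicalFieldType) (X : lmodType F) := DualPair {
  dp_functionals : {pred X -> F^o} ;
  dp_scalar : {in dp_functionals, forall f, scalar f} ;
  dp_submod : GRing.submod_closed dp_functionals ;
  dp_separating : forall x : X, {in dp_functionals, forall f, f x = 0} -> x = 0
}.

Section DualPair.
Variables (F : topologicalFieldType) (X : lmodType F) (D : dual_pair X).

Record dualY := Dual {
  dual_fun :> X -> F^o ;
  dualP : dual_fun \in dp_functionals D
}.

HB.instance Definition _ := [isSub for dual_fun].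
HB.instance Definition _ := [Choice of dualY by <:].
HB.instance Definition _ := GRing.SubChoice_isSubLmodule.Build F _ _ dualY
  (GRing.submod_closed_semi (dp_submod D)).

Lemma dual_scalar (f : dualY) : scalar f.
Proof. exact: dp_scalar (dualP f). Qed.

HB.instance Definition _ (f : dualY) :=
  GRing.isLinear.Build F X F *%R f (dual_scalar f).

Definition dual_eval (x : X) (f : dualY) : F := f x.

Fact dual_eval_scalar x : scalar (dual_eval x).
Proof. by []. Qed.

HB.instance Definition _ (x : X) :=
  GRing.isLinear.Build F dualY F *%R (dual_eval x) (dual_eval_scalar x).

Lemma dual_eq (f g : dualY) : (forall x, f x = g x) -> f = g.
Proof. by move=> h; apply: val_inj; apply/funext. Qed.

Definition dual_pairing (f : dualY) : {scalar X} := f.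
Definition dual_copairing (x : X) : {scalar dualY} := dual_eval x.

Definition sigmaX : Type := sigma_space dual_pairing.
Definition sigmaY : Type := sigma_space dual_copairing.
HB.instance Definition _ := Topological.on sigmaX.
HB.instance Definition _ := Topological.on sigmaY.

Definition LX : Type := sigma_endo dual_pairing.
Definition LY : Type := sigma_endo dual_copairing.
HB.instance Definition _ := GRing.PzRing.on LX.
HB.instance Definition _ := GRing.Lmodule.on LX.
HB.instance Definition _ := GRing.PzRing.on LY.
HB.instance Definition _ := GRing.Lmodule.on LY.

(* The functional x (x) f on LX. *)
Definition tensor (x : X) (f : dualY) (T : LX) : F := f (T x).

Fact tensor_scalar x f : scalar (tensor x f).
Proof. by move=> k T S; rewrite /tensor -[RHS]linearP. Qed.

HB.instance Definition _ (x : X) (f : dualY) :=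
  GRing.isLinear.Build F LX F *%R (tensor x f) (tensor_scalar x f).

Lemma dual_of_kernels (s : seq dualY) (g : X -> F^o) : scalar g ->
  (forall z, (forall f, f \in s -> f z = 0) -> g z = 0) ->
  g \in dp_functionals D.
Proof.
have [D0 DL] := dp_submod D.
elim: s g => [|f s IH] g lg hg.
  have -> : g = 0 by apply/funext => z; exact: hg.
  exact: D0.
have [fker|] := pselect (forall z, (forall f, f \in s -> f z = 0) -> f z = 0).
  apply: IH => // z hz; apply: hg => h; rewrite inE => /orP[/eqP->|/hz//].
  exact: fker.
move=> /existsNP[z0 /not_implyP[z0s /eqP fz0]].
pose c : F := g z0 / f z0.
have gE : g = c *: (f : X -> F^o) + (g - c *: (f : X -> F^o)).
  by rewrite addrC subrK.
rewrite gE; apply: DL; first exact: dualP.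
apply: IH => [a u v|z hz].
  rewrite !fctE lg (dual_scalar f) /GRing.scale /= mulrBr mulrDr opprD addrACA.
  by rewrite (mulrCA c a).
have : g (- (f z / f z0) *: z0 + z) = 0.
  apply: hg => h; rewrite inE linearD linearZ /= => /orP[/eqP->|hs].
    by rewrite mulNr divfK ?addNr.
  by rewrite (hz h) // (z0s h) // mulr0 addr0.
rewrite lg !fctE /c /GRing.scale /= => <-; rewrite addrC mulNr.
by congr (- _ + _); rewrite -mulrA mulrC (mulrC (f z)).
Qed.

(* Only here is the Hausdorff axiom used: a sigma(X,Y)-continuous linear
   functional belongs to Y. *)
Lemma dual_of_continuous (g : X -> F^o) : hausdorff_space F -> scalar g ->
  continuous (g : sigmaX -> F) -> g \in dp_functionals D.
Proof.
move=> hF lg cg.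
have g0 : g 0 = 0.
  by move: (lg (-1) 0 0); rewrite scaler0 addr0 mulN1r addNr.
have gZ k u : g (k *: u) = k * g u.
  by move: (lg k u 0); rewrite !addr0 g0 addr0.
pose G : set_system X := fun U =>
  exists s : seq dualY, forall z, (forall f, f \in s -> f z = 0) -> U z.
have FG : Filter G.
  split; first by exists [::].
  - move=> P Q [s hs] [t ht]; exists (s ++ t) => z hz.
    by split; [apply: hs|apply: ht] => f fs; apply: hz; rewrite mem_cat fs ?orbT.
  - by move=> P Q PQ [s hs]; exists s => z /hs/PQ.
have G0 : G --> (0 : sigma_space dual_pairing).
  apply/cvg_sigma => f U [_ [[W oW <-] W0 WU]].
  exists [:: f] => z hz; apply: WU => /=.
  have /= := W0; rewrite /dual_pairing (hz f) ?mem_head //.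
  by rewrite linear0.
have /(hausdorff_accessible hF)[U [oU U0 U1]] : (0 : F) != 1.
  by rewrite eq_sym oner_neq0.
have [|s hs] := G0 (g @^-1` U).
  apply: (cg (0 : X)); rewrite g0.
  by apply: open_nbhs_nbhs; split=> //; rewrite inE in U0.
apply: (@dual_of_kernels s) => // z hz; apply/eqP/negPn/negP => gz.
have /hs : forall f, f \in s -> f ((g z)^-1 *: z) = 0.
  by move=> f fs; rewrite linearZ /= hz // mulr0.
by rewrite /= gZ mulVf //; rewrite inE in U1.
Qed.

Section Adjoint.
Hypothesis hF : hausdorff_space F.

Fact adjoint_dualP (T : LX) (f : dualY) :
  (fun x => f (T x) : F^o) \in dp_functionals D.
Proof.
apply: dual_of_continuous => // [k u v|x]; first by rewrite !linearP.
apply: (@continuous_comp sigmaX sigmaX F T f).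
  exact: sigma_endo_continuous.
exact: (@sigma_continuous _ _ _ dual_pairing f).
Qed.

Definition adjoint_fun (T : LX) (f : dualY) : dualY := Dual (adjoint_dualP T f).

Fact adjointP (T : LX) : adjoint_fun T \in sigma_endo_pred dual_copairing.
Proof.
apply/asboolP; split=> [k f g|]; first exact: dual_eq.
apply: continuous_sigma => x.
exact: (@sigma_continuous _ _ _ dual_copairing (T x)).
Qed.

Definition adjoint (T : LX) : LY := SigmaEndo (adjointP T).

End Adjoint.

Lemma adjointE hF (T : LX) (f : dualY) (x : X) : adjoint hF T f x = f (T x).
Proof. by []. Qed.

Definition orbitX (A : set LX) (x : X) : set sigmaX := [set T x | T in A].
Definition orbitY (A : set LY) (f : dualY) : set sigmaY := [set S f | S in A].

End DualPair.

(* Main.v *)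
Require Import Defs.
From mathcomp Require Import all_boot all_algebra.
From mathcomp Require Import boolp classical_sets functions topology tvs.

Local Open Scope classical_set_scope.
Local Open Scope ring_scope.

Import GRing.Theory.

(** Write phi for the functional [tensor x alpha].

    Suppose the three conditions hold and let C be a phi-tracial algebra
    containing A.  For T in C and a, b, c in A, traciality on C and
    commutativity of A give
      phi (a T b c) = phi (T b c a) = phi (T c a b) = phi (a b T c),
    so every functional a^# alpha vanishes at (T b - b T) c x.  As these
    functionals are dense in Y, (T b - b T) c x = 0; as the vectors c x are dense
    in X, T b = b T.  Hence T commutes with A and, A being maximal abelian,
    belongs to A.

    Conversely, let A be maximal tracial.  An abelian algebra containing A is
    phi-tracial, hence equal to A.  If A x is not dense, some nonzero beta in Y
    annihilates it.  The operators that vanish on A x form a space N on which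
    phi is zero and which absorbs products with A and with itself; then A + N is
    phi-tracial, so that N lies in A and is commutative ([absorbed_subset]).
    But N contains the rank-one operators v |-> beta v *: y for all y, and these
    do not commute.  The density of A^# alpha is obtained in the same way from
    the operators whose range is annihilated by A^# alpha.

    Over an arbitrary topological field no Hahn-Banach theorem is at hand;
    the annihilating functional comes from linear algebra, since a
    neighbourhood for a weak topology only constrains finitely many of the
    functionals that define it ([weak_separation]). *)

(** * Weak topologies *)

Section WeakTopology.
Set Implicit Arguments. Unset Strict Implicit.
Context (F : topologicalFieldType) (V : lmodType F) (I : Type).
Context (e : I -> {scalar V}).

(** The filter of the sets containing all v' that agree with v on finitely many
    functionals converges to v: it is the neighbourhood filter of v when F is
    discrete, and a coarser topology on F only has fewer neighbourhoods. *)
Lemma closure_agreement (M : set V) (v : V) :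
  (forall s : seq I, exists2 m, M m & all (fun i => e i m == e i v) s) ->
  closure (M : set (sigma_space e)) v.
Proof.
move=> hM.
pose G : set_system V := fun U =>
  exists s : seq I, forall m, all (fun i => e i m == e i v) s -> U m.
have FG : Filter G.
  split; first by exists [::].
  - move=> P Q [s hs] [t ht]; exists (s ++ t) => m.
    by rewrite all_cat => /andP[/hs ? /ht ?].
  - by move=> P Q PQ [s hs]; exists s => m /hs/PQ.
have Gv : G --> (v : sigma_space e).
  apply/cvg_sigma => i U [_ [[W oW <-] Wv WU]].
  by exists [:: i] => m /=; rewrite andbT => /eqP mv; apply: WU; rewrite /= mv.
by move=> U /Gv[s hs]; have [m Mm /hs Um] := hM s; exists m.
Qed.

(** If e i is not constantly zero on M, subtract from v an element of M with the
    same value under e i and restrict to the kernel of e i: one functional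
    fewer then remains to be treated. *)
Lemma finite_separation
    (eL : forall k i j, exists l, forall v, e l v = k * e i v + e j v)
    (s : seq I) (M : set V) (v : V) :
  M 0 -> (forall k u w, M u -> M w -> M (k *: u + w)) ->
  (forall m, M m -> has (fun i => e i m != e i v) s) ->
  exists2 l, (forall m, M m -> e l m = 0) & e l v != 0.
Proof.
elim: s M v => [|i s IH] M v M0 ML hM; first by have := hM _ M0.
have [eiM|] := pselect (forall m, M m -> e i m = 0).
  have [eiv|eiv] := eqVneq (e i v) 0; last by exists i.
  apply: IH => // m Mm; have := hM m Mm.
  by rewrite /= eiM // eiv eqxx.
move=> /existsNP[m0 /not_implyP[Mm0 /eqP em0]].
pose m1 := (e i v / e i m0) *: m0.
have Mm1 : M m1 by rewrite -[m1]addr0; exact: ML.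
have em1 : e i m1 = e i v by rewrite linearZ /= divfK.
have [||m [Mm em]|l lM lv] := IH (fun m => M m /\ e i m = 0) (v - m1).
- by split=> //; rewrite linear0.
- move=> k u w [Mu eu] [Mw ew]; split; first exact: ML.
  by rewrite linearP /= eu ew mulr0 addr0.
- have : M (m + m1) by rewrite -[m]scale1r; exact: ML.
  move=> /hM /=; rewrite linearD /= em add0r em1 eqxx /=.
  apply: sub_has => j; apply: contra_neq => emj.
  by rewrite linearD /= emj linearB /= subrK.
(* e l - (e l m0 / e i m0) e i vanishes at m0, and agrees with e l on ker e i. *)
have [l' el'] := eL (- (e l m0 / e i m0)) i l.
have l'M m : M m -> e l' m = 0.
  (* Apply lM to the component of m in ker e i along m0. *)
  move=> Mm; have := lM (- (e i m / e i m0) *: m0 + m).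
  rewrite !linearP /= !el' mulNr divfK // addNr.
  move=> /(_ (conj (ML _ _ _ Mm0 Mm) erefl)) <-; congr (_ + _).
  by rewrite !mulNr mulrAC [in RHS]mulrAC (mulrC (e i m)).
exists l' => //.
rewrite -(subrK m1 v) linearD /= (l'M m1) // addr0 el'.
by rewrite linearB /= em1 subrr mulr0 add0r.
Qed.

(** Closure of the family e under linear combinations holds on both sides of a
    dual pair, where it makes the annihilating functional an element of Y, or
    the evaluation at a point of X. *)
Lemma weak_separation
    (eL : forall k i j, exists l, forall v, e l v = k * e i v + e j v)
    (M : set V) :
  M 0 -> (forall k u w, M u -> M w -> M (k *: u + w)) ->
  closure (M : set (sigma_space e)) <> setT ->
  exists (l : I) (v : V), (forall m, M m -> e l m = 0) /\ e l v != 0.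
Proof.
move=> M0 ML clM.
have [v ncl] : exists v, ~ closure (M : set (sigma_space e)) v.
  by apply/existsNP => clv; apply: clM; apply/seteqP; split=> // v _; exact: clv.
have [s hs] : exists s : seq I,
    forall m, M m -> has (fun i => e i m != e i v) s.
  apply: contrapT => /forallNP hs; apply/ncl/closure_agreement => s.
  have /existsNP[m /not_implyP[Mm /negP]] := hs s.
  rewrite -all_predC => ms; exists m => //.
  by apply: sub_all ms => i /=; rewrite negbK.
by have [l lM lv] := finite_separation eL M0 ML hs; exists l, v.
Qed.

Lemma dense_eq0 (hF : hausdorff_space F) (M : set V) (i : I) :
  closure (M : set (sigma_space e)) = setT ->
  (forall m, M m -> e i m = 0) -> forall v, e i v = 0.
Proof.
move=> clM eM v.
have cl0 : closed ((e i : sigma_space e -> F) @^-1` [set 0]).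
  have /continuous_closedP := @sigma_continuous _ _ _ e i; apply.
  by apply: accessible_closed_set1; exact: hausdorff_accessible.
have : closure (M : set (sigma_space e)) v by rewrite clM.
rewrite closureE => clv.
exact: (clv ((e i : sigma_space e -> F) @^-1` [set 0]) (conj cl0 eM)).
Qed.

End WeakTopology.

(** * Subalgebras *)

Section Subalgebras.
Set Implicit Arguments. Unset Strict Implicit.
Context {F : topologicalFieldType} {V : lmodType F} {I : Type}.
Context {e : I -> {scalar V}}.
Notation L := (sigma_endo e).
Implicit Types (A C N : set L) (phi : {scalar L}).

Lemma subalgebraP A : subalgebra A <->
  [/\ A 0, forall k T S, A T -> A S -> A (k *: T + S) &
      forall T S, A T -> A S -> A (T * S)].
Proof.
split=> [[[A0 AL] AM]|[A0 AL AM]].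
  split; first by have := A0; rewrite inE.
  - move=> k T S AT AS; have := AL k T S; rewrite !inE; exact.
  - move=> T S AT AS; have := AM T S; rewrite !inE; exact.
split; first (split; first by rewrite inE).
  by move=> k T S; rewrite !inE; exact: AL.
by move=> T S; rewrite !inE; exact: AM.
Qed.

Definition commutant (B : set L) : set L :=
  [set T | forall S, B S -> T * S = S * T].

Lemma commutant_subalgebra (B : set L) : subalgebra (commutant B).
Proof.
apply/subalgebraP; split.
- by move=> S _; rewrite mul0r mulr0.
- move=> k T U hT hU S BS.
  by rewrite mulrDl mulrDr -sigma_endo_scalerAl -sigma_endo_scalerAr hT ?hU.
- by move=> T U hT hU S BS; rewrite -mulrA hU // mulrA hT // mulrA.
Qed.

(** The bicommutant of a set of commuting operators is an abelian algebra, so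
    the bicommutant of A together with T cannot be larger than A. *)
Lemma maximal_abelian_commutant A : maximal_abelian A ->
  commutant A `<=` A.
Proof.
move=> [[_ cA] mA] T cT.
pose B := A `|` [set T].
have BB : B `<=` commutant B.
  move=> S [AS|->] U [AU|->] //; first exact: cA.
  - by rewrite cT.
  - exact: cT.
have BC : B `<=` commutant (commutant B) by move=> S BS U cU; rewrite cU.
apply: contrapT => nAT; apply: (mA (commutant (commutant B))).
  split; first exact: commutant_subalgebra.
  by move=> S U hS hU; apply: hS => W BW; apply: hU; exact: BB.
split=> [S AS|sub]; first by apply: BC; left.
by apply/nAT/sub/BC; right.
Qed.

Lemma maximal_tracial_abelian phi A : abelian_subalgebra A -> A 1 ->
  maximal_tracial phi A -> maximal_abelian A.
Proof.
move=> abA A1 [_ mA]; split=> // C [sC cC] AC; apply: (mA C) => //.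
split=> //; first exact: AC.1.
by move=> T S CT CS; rewrite cC.
Qed.

(** The sum A + N is phi-tracial: modulo N, where phi is zero, its products are
    products of elements of A. *)
Lemma absorbed_subset phi A N : maximal_tracial phi A ->
  N 0 -> (forall k S T, N S -> N T -> N (k *: S + T)) ->
  (forall S T, N S -> N T -> N (S * T)) ->
  (forall a T, A a -> N T -> N (a * T) /\ N (T * a)) ->
  (forall T, N T -> phi T = 0) ->
  N `<=` A.
Proof.
move=> [[/subalgebraP[A0 AL AM] A1 trA] mA] N0 NL NM NA phiN.
pose C : set L := fun T => exists a n, [/\ A a, N n & T = a + n].
have ND S T : N S -> N T -> N (S + T) by rewrite -{2}[S]scale1r; exact: NL.
have AC : A `<=` C by move=> a Aa; exists a, 0; rewrite addr0.
have mulC a n b m : A a -> N n -> A b -> N m ->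
    exists2 p, N p & (a + n) * (b + m) = a * b + p.
  move=> Aa Nn Ab Nm; exists (a * m + (n * b + n * m)).
    apply: (ND _ _ (NA a m Aa Nm).1).
    by apply: (ND _ _ (NA b n Ab Nn).2); exact: NM.
  by rewrite mulrDl !mulrDr -!addrA.
have trC : tracial phi C.
  split; [apply/subalgebraP; split|exact: AC|].
  - exact: AC.
  - move=> k _ _ [a [n [Aa Nn ->]]] [b [m [Ab Nm ->]]].
    exists (k *: a + b), (k *: n + m); split; [exact: AL|exact: NL|].
    by rewrite scalerDr addrACA.
  - move=> _ _ [a [n [Aa Nn ->]]] [b [m [Ab Nm ->]]].
    have [p Np ->] := mulC _ _ _ _ Aa Nn Ab Nm.
    by exists (a * b), p; split=> //; exact: AM.
  - move=> _ _ [a [n [Aa Nn ->]]] [b [m [Ab Nm ->]]].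
    have [p Np ->] := mulC _ _ _ _ Aa Nn Ab Nm.
    have [q Nq ->] := mulC _ _ _ _ Ab Nm Aa Nn.
    by rewrite !linearD /= (phiN p) // (phiN q) // trA.
move=> T NT; apply: contrapT => nAT; apply: (mA C trC).
by split=> // CA; apply/nAT/CA; exists 0, T; rewrite add0r.
Qed.

End Subalgebras.

(** * Operators on a dual pair *)

Section DualPairOperators.
Set Implicit Arguments. Unset Strict Implicit.
Context {F : topologicalFieldType} {X : lmodType F} {D : dual_pair X}.

Fact rank_oneP (f : dualY D) (y : X) :
  (fun v => f v *: y) \in sigma_endo_pred (@dual_pairing F X D).
Proof.
apply/asboolP; split=> [k u v|]; first by rewrite linearP scalerDl scalerA.
apply: continuous_sigma => g v.
have -> : (fun z : sigmaX D => dual_pairing g (f z *: y)) =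
          (fun z : sigmaX D => g y * f z + 0).
  by apply/funext => z; rewrite addr0 /dual_pairing linearZ /= mulrC.
apply: (@cvg_linear_comb F (sigmaX D) _ (nbhs_filter v) f (fun=> 0) (g y)
  (f v) 0).
  exact: (@sigma_continuous _ _ _ (@dual_pairing F X D) f).
exact: cvg_cst.
Qed.

Definition rank_one (f : dualY D) (y : X) : LX D := SigmaEndo (rank_oneP f y).

Lemma dual_eq0 (v : X) : (forall f : dualY D, f v = 0) -> v = 0.
Proof.
by move=> fv; apply: (@dp_separating _ _ D) => f Df; exact: (fv (Dual Df)).
Qed.

Lemma orbit_annihilator (A : set (LX D)) (x : X) :
  subalgebra A -> closure (orbitX A x) <> setT ->
  exists (beta : dualY D) (y : X),
    (forall a, A a -> beta (a x) = 0) /\ beta y != 0.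
Proof.
move=> /subalgebraP[A0 AL _] clA.
have [||||beta [y [bA by0]]] :=
    @weak_separation _ _ _ (@dual_pairing F X D) _ (orbitX A x).
- by move=> k f g; exists (k *: f + g).
- by exists 0.
- by move=> k _ _ [a Aa <-] [b Ab <-]; exists (k *: a + b); first exact: AL.
- exact: clA.
by exists beta, y; split=> // a Aa; apply: bA; exists a.
Qed.

Lemma adjoint_orbit_annihilator (hF : hausdorff_space F) (A : set (LX D))
    (alpha : dualY D) :
  subalgebra A -> closure (orbitY (adjoint hF @` A) alpha) <> setT ->
  exists (z : X) (f : dualY D),
    (forall a, A a -> alpha (a z) = 0) /\ f z != 0.
Proof.
move=> /subalgebraP[A0 AL _] clA.
have [||||z [f [zA zf]]] := @weak_separation _ _ _ (@dual_copairing F X D) _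
    (orbitY (adjoint hF @` A) alpha).
- move=> k u v; exists (k *: u + v) => f.
  by rewrite /dual_copairing /= /dual_eval linearP.
- exists (adjoint hF 0); first by exists 0.
  by apply: dual_eq => v; rewrite adjointE linear0.
- move=> k _ _ [_ [a Aa <-] <-] [_ [b Ab <-] <-].
  exists (adjoint hF (k *: a + b)); first by exists (k *: a + b); first exact: AL.
  by apply: dual_eq => v; rewrite adjointE linearP.
- exact: clA.
exists z, f; split=> // a Aa.
by apply: (zA (adjoint hF a alpha)); exists (adjoint hF a) => //; exists a.
Qed.

(** The operators vanishing on A x form a left ideal N absorbed by A.  When beta
    annihilates A x, N contains [rank_one beta x] and [rank_one beta y]; their
    product in one order is zero, in the other it maps y to (beta y)^2 *: x. *)
Lemma maximal_tracial_orbit_dense (A : set (LX D)) (x : X) (alpha : dualY D) :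
  abelian_subalgebra A -> A 1 -> tensor x alpha 1 = 1 ->
  maximal_tracial (tensor x alpha) A -> closure (orbitX A x) = setT.
Proof.
move=> [sA cA] A1 hx mA; apply: contrapT => /(orbit_annihilator sA).
move=> [beta [y [bA /eqP by0]]].
have [_ _ AM] := (subalgebraP A).1 sA.
pose N : set (LX D) := [set T | forall a, A a -> T (a x) = 0].
have NA : N `<=` A.
  apply: (absorbed_subset mA)
    => [a _|k S T NS NT a Aa|S T NS NT a Aa|a T Aa NT|T NT].
  - by [].
  - by rewrite sigma_endoD sigma_endoZ NS // NT // scaler0 addr0.
  - by rewrite sigma_endoME NT // linear0.
  - split=> b Ab; first by rewrite sigma_endoME NT // linear0.
    by rewrite sigma_endoME -[a (b x)]sigma_endoME NT //; exact: AM.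
  - by have := NT 1 A1; rewrite sigma_endo1E /= /tensor => ->; rewrite linear0.
have NR z : N (rank_one beta z) by move=> a Aa; rewrite /= bA // scale0r.
have bx : beta x = 0 := bA 1 A1.
have /(congr1 (fun T : LX D => alpha (T y))) :=
  cA _ _ (NA _ (NR x)) (NA _ (NR y)).
have ax : alpha x = 1 := hx.
rewrite !sigma_endoME /= !linearZ /= bx ax mulr0 mul0r mulr1 => /eqP.
by rewrite mulf_eq0 orbb => /eqP.
Qed.

(** Dually, the operators whose range is annihilated by A^# alpha form a right
    ideal N absorbed by A.  When A^# alpha annihilates z, N contains
    [rank_one f z] and [rank_one alpha z]; their product in one order is zero,
    in the other it maps x to (f z) *: z. *)
Lemma maximal_tracial_adjoint_orbit_dense (hF : hausdorff_space F)
    (A : set (LX D)) (x : X) (alpha : dualY D) :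
  abelian_subalgebra A -> A 1 -> tensor x alpha 1 = 1 ->
  maximal_tracial (tensor x alpha) A ->
  closure (orbitY (adjoint hF @` A) alpha) = setT.
Proof.
move=> [sA cA] A1 hx mA; apply: contrapT => /(adjoint_orbit_annihilator sA).
move=> [z [f [zA /eqP fz]]].
have [_ _ AM] := (subalgebraP A).1 sA.
pose N : set (LX D) := [set T | forall a v, A a -> alpha (a (T v)) = 0].
have NA : N `<=` A.
  apply: (absorbed_subset mA)
    => [a v _|k S T NS NT a v Aa|S T NS NT a v Aa|a T Aa NT|T NT].
  - by rewrite !linear0.
  - by rewrite sigma_endoD sigma_endoZ !linearP /= NS // NT // mulr0 addr0.
  - by rewrite sigma_endoME NS.
  - split=> b v Ab; last by rewrite sigma_endoME NT.
    by rewrite sigma_endoME -[b (a _)]sigma_endoME NT //; exact: AM.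
  - exact: (NT 1 x A1).
have NR g : N (rank_one g z) by move=> a v Aa; rewrite /= !linearZ /= zA // mulr0.
have az : alpha z = 0 := zA 1 A1.
have /(congr1 (fun T : LX D => f (T x))) :=
  cA _ _ (NA _ (NR f)) (NA _ (NR alpha)).
have ax : alpha x = 1 := hx.
rewrite !sigma_endoME /= !linearZ /= az ax mul1r mulr0 mul0r => /eqP.
by rewrite mulf_eq0 orbb => /eqP.
Qed.

(** The equality phi (a T b c) = phi (a b T c) holds by cyclic permutation inside
    C and commutativity inside A.  It says that the functional a^# alpha
    vanishes at (T b - b T) c x. *)
Lemma tracial_extension_commutes (hF : hausdorff_space F)
    (A C : set (LX D)) (x : X) (alpha : dualY D) :
  abelian_subalgebra A ->
  closure (orbitX A x) = setT ->
  closure (orbitY (adjoint hF @` A) alpha) = setT ->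
  tracial (tensor x alpha) C -> A `<=` C -> C `<=` commutant A.
Proof.
move=> [sA cA] clX clY [/subalgebraP[_ _ CM] _ trC] AC T CT b Ab.
have [_ _ AM] := (subalgebraP A).1 sA.
have key a c : A a -> A c ->
    tensor x alpha (a * (T * b) * c) = tensor x alpha (a * (b * T) * c).
  move=> Aa Ac; have [Ca Cb Cc] := And3 (AC _ Aa) (AC _ Ab) (AC _ Ac).
  have -> : a * (T * b) * c = a * (T * (b * c)) by rewrite !mulrA.
  have -> : a * (b * T) * c = (a * b) * (T * c) by rewrite !mulrA.
  rewrite trC //; last exact: (CM _ _ CT (CM _ _ Cb Cc)).
  rewrite [RHS]trC //; [|exact: CM|exact: CM].
  by rewrite -!mulrA (cA a b) // (mulrA b c) (cA b c) // -mulrA (cA b a).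
have vanish c : A c -> forall f : dualY D, f ((T * b - b * T) (c x)) = 0.
  move=> Ac; apply: (dense_eq0 (e := @dual_copairing F X D) hF clY).
  move=> _ [_ [a Aa <-] <-] /=; have /eqP := key a c Aa Ac.
  by rewrite -subr_eq0 -linearB -mulrBl -mulrBr => /eqP.
apply/eqP; rewrite -subr_eq0; apply/eqP/sigma_endo_eq => v.
apply: dual_eq0 => f.
have fTP : (fun v : X => f ((T * b - b * T) v) : F^o) \in dp_functionals D.
  exact: (adjoint_dualP hF (T * b - b * T) f).
apply: (dense_eq0 (e := @dual_pairing F X D) (i := Dual fTP) hF clX).
by move=> _ [c Ac <-]; exact: vanish.
Qed.

End DualPairOperators.

Theorem theorem2p3 (F : topologicalFieldType) (hF : hausdorff_space F)
    (X : lmodType F) (D : dual_pair X) (A : set (LX D))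
    (hA : abelian_subalgebra A) (hA1 : A 1)
    (x : X) (alpha : dualY D) (hx : tensor x alpha 1 = 1) :
  maximal_tracial (tensor x alpha) A <->
  [/\ maximal_abelian A,
      closure (orbitX A x) = setT &
      closure (orbitY (adjoint hF @` A) alpha) = setT].
Proof.
split=> [mA|[mA clX clY]].
  split; first exact: maximal_tracial_abelian mA.
    exact: maximal_tracial_orbit_dense mA.
  exact: maximal_tracial_adjoint_orbit_dense mA.
split; first by split=> [||a b Aa Ab]; [exact: hA.1| |rewrite hA.2].
move=> C trC [AC]; apply.
have := tracial_extension_commutes hA clX clY trC AC.
by move=> /subset_trans; apply; exact: maximal_abelian_commutant.
Qed.
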